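(* Let $\Omega\subset\mathbb{C}$ be a nonempty open set, let $S=\{x-\overline{y}:x,y\in\Omega\}$, and let $f:S\to\mathbb{C}$ be a positive definite function. If $f$ is holomorphic on an open set $U\subseteq S$ containing $D_\Omega(S)=\{x-\overline{x}:x\in\Omega\}$, then $f$ is holomorphic in $S$.
   Context: In this complex-variable setting, $f:S\to\mathbb{C}$ with $S=\{x-\overline{y}:x,y\in\Omega\}$ (the codifference set of $\Omega$) is called a positive definite function if $k(x,y)=f(x-\overline{y})$ is a positive definite kernel on $\Omega$, that is, $\sum_{i,j=1}^n f(x_i-\overline{x_j})\,\xi_i\,\overline{\xi_j}\ge 0$ for every $n\in\mathbb{N}$ and all finite collections $\{x_j\}_{j=1}^n\subset\Omega$ and $\{\xi_j\}_{j=1}^n\subset\mathbb{C}$. *)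

(* Defs.v *)
From Stdlib Require Import Reals.
From Coquelicot Require Export Coquelicot.

Open Scope R_scope.

Definition codifference (Omega : C -> Prop) (z : C) : Prop :=
  exists x y : C, Omega x /\ Omega y /\ z = (x - Cconj y)%C.

Definition diag_codifference (Omega : C -> Prop) (z : C) : Prop :=
  exists x : C, Omega x /\ z = (x - Cconj x)%C.

(** [Cnonneg z] is the usual meaning of "[z >= 0]" for a complex number:
    [z] is real and nonnegative. *)
Definition Cnonneg (z : C) : Prop := Im z = 0 /\ 0 <= Re z.

(** The points and coefficients are indexed by [1, ..., n]; repetitions among
    the points are allowed. *)
Definition positive_definite_kernel (Omega : C -> Prop) (k : C -> C -> C) :
    Prop :=
  forall (n : nat) (x xi : nat -> C),
    (forall j : nat, (1 <= j <= n)%nat -> Omega (x j)) ->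
    Cnonneg
      (sum_n_m (fun i : nat =>
         sum_n_m (fun j : nat => k (x i) (x j) * xi i * Cconj (xi j))%C 1 n)
       1 n).

(** A function on [codifference Omega] is represented by a total function
    [f : C -> C]; only its values on [codifference Omega] are constrained. *)
Definition positive_definite_function (Omega : C -> Prop) (f : C -> C) :
    Prop :=
  positive_definite_kernel Omega (fun x y : C => f (x - Cconj y)%C).

(** Complex differentiability at every point of [U].  This is used only for
    open [U] ([codifference Omega] is open when [Omega] is), so it does not
    depend on the values of [f] outside [U]. *)
Definition holomorphic_on (U : C -> Prop) (f : C -> C) : Prop :=
  forall z : C, U z -> ex_derive (K := C_AbsRing) (V := C_NormedModule) f z.

(* Main.v *)
Require Import Defs.
From Stdlib Require Import Reals.
From Coquelicot Require Import Coquelicot.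
From Stdlib Require Import Lra Lia List.
Import ListNotations.

(** Positive definiteness puts a semi-inner product on finite combinations of
    the kernel functions [k_x : y |-> f (x - Cconj y)], with
    [<k_x, k_y> = f (x - Cconj y)].  To differentiate [f] at
    [x0 - Cconj y0] it is enough to differentiate [x |-> k_x] at [x0] in norm,
    since Cauchy-Schwarz against [k_y0] transports the error estimate to [y0].
    Differentiability in norm involves only [<k_x, k_y>] with [x] and [y] close
    to [x0], that is, the values of [f] near the diagonal point
    [x0 - Cconj x0], where [f] is holomorphic.

    The classical way to finish is to expand [f] to second order at
    [x0 - Cconj x0], which rests on Cauchy's integral formula.  Here positivity
    supplies the second-order information instead, and bare complex
    differentiability near the diagonal suffices.  Imaginary translations of the
    two arguments of the kernel add up, so the squared norm of an imaginary
    difference [delta s u] is a second difference of the real function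
    [autocorr f u], and that second difference is itself convex
    ([autocorr_midpoint]).  A convex second difference of a bounded function has
    order [s ^ 2] ([sqnorm_delta_le]), and doing this twice bounds
    [delta s (delta t k_x)] by a constant times [s * t]
    ([sqnorm_delta_delta_le]).

    All further steps use the dual norm [dual_le], which also applies to
    pointwise limits of combinations.  Letting [s] tend to [0] bounds the
    imaginary difference quotients of the derivative of [k_x]; the mean value
    inequality in any complex direction, followed by [t] tending to [0], makes
    that derivative Lipschitz in norm ([dual_le_deriv_lipschitz]); a second use
    of the mean value inequality gives a quadratic first-order error
    ([dual_le_taylor]).  Replacing the derivative by secants, which are finite
    combinations, allows the error to be evaluated at an arbitrary [y0]
    ([secant_error]), and the secant slopes converge to the derivative of [f] at
    [x0 - Cconj y0] ([has_Cderiv_of_secants]). *)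

Open Scope R_scope.

(** * Formal combinations of kernel functions *)

(** A list of pairs [(a, x)] stands for the formal combination of the kernel
    functions at the points [x] with coefficients [a].  When [F] is such a
    combination, [pairing F v] is its inner product with [v]; allowing an
    arbitrary [F] lets pointwise limits and derivatives be paired as well. *)
Fixpoint pairing (F : C -> C) (v : list (C * C)) : C :=
  match v with
  | [] => 0
  | p :: v' => (Cconj (fst p) * F (snd p) + pairing F v')%C
  end.

Fixpoint kernel_comb (f : C -> C) (u : list (C * C)) (y : C) : C :=
  match u with
  | [] => 0
  | p :: u' => (fst p * f (snd p - Cconj y) + kernel_comb f u' y)%C
  end.

Definition form (f : C -> C) (u v : list (C * C)) : C :=
  pairing (kernel_comb f u) v.

(** The form is real on the diagonal when [f] is positive definite, so nothing
    is lost in taking the real part. *)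
Definition sqnorm (f : C -> C) (v : list (C * C)) : R := Re (form f v v).

Definition supported (P : C -> Prop) (v : list (C * C)) : Prop :=
  List.Forall (fun p => P (snd p)) v.

Definition scale (c : C) (u : list (C * C)) : list (C * C) :=
  map (fun p => ((c * fst p)%C, snd p)) u.

Definition shift (c : C) (u : list (C * C)) : list (C * C) :=
  map (fun p => (fst p, (snd p + c)%C)) u.

(** Differences are taken in the imaginary direction because the kernel is convex
    there.  Along real translations it is largest at [0], and boundedness would
    not control differences. *)
Definition delta (s : R) (u : list (C * C)) : list (C * C) :=
  shift (Ci * s) u ++ scale (-1) u.

Definition positive_on (P : C -> Prop) (f : C -> C) : Prop :=
  forall v, supported P v -> Cnonneg (form f v v).

Definition Cdisc (c : C) (r : R) (z : C) : Prop := Cmod (z - c) < r.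

(** * Bilinear algebra of the form *)

Lemma pairing_ext (P : C -> Prop) (F G : C -> C) v :
  (forall y, P y -> F y = G y) -> supported P v -> pairing F v = pairing G v.
Proof.
  intros H Hv. induction Hv as [|p v Hp Hv IH]; simpl; trivial.
  now rewrite IH, H.
Qed.

Lemma pairing_ext_all (F G : C -> C) v :
  (forall y, F y = G y) -> pairing F v = pairing G v.
Proof.
  intros H. induction v as [|p v IH]; simpl; trivial. now rewrite IH, H.
Qed.

Lemma pairing_app F u v :
  pairing F (u ++ v) = (pairing F u + pairing F v)%C.
Proof. induction u as [|p u IH]; simpl; [|rewrite IH]; ring. Qed.

Lemma pairing_plus F G v :
  pairing (fun y => F y + G y)%C v = (pairing F v + pairing G v)%C.
Proof. induction v as [|p v IH]; simpl; [|rewrite IH]; ring. Qed.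

Lemma pairing_scal c F v :
  pairing (fun y => c * F y)%C v = (c * pairing F v)%C.
Proof. induction v as [|p v IH]; simpl; [|rewrite IH]; ring. Qed.

Lemma pairing_scale c F v :
  pairing F (scale c v) = (Cconj c * pairing F v)%C.
Proof.
  induction v as [|p v IH]; simpl; [|rewrite IH, Cmult_conj]; ring.
Qed.

Lemma pairing_shift c F v :
  pairing F (shift c v) = pairing (fun y => F (y + c)%C) v.
Proof. induction v as [|p v IH]; simpl; [|rewrite IH]; ring. Qed.

Lemma kernel_comb_app f u v y :
  kernel_comb f (u ++ v) y = (kernel_comb f u y + kernel_comb f v y)%C.
Proof. induction u as [|p u IH]; simpl; [|rewrite IH]; ring. Qed.

Lemma kernel_comb_scale f c u y :
  kernel_comb f (scale c u) y = (c * kernel_comb f u y)%C.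
Proof. induction u as [|p u IH]; simpl; [|rewrite IH]; ring. Qed.

Lemma kernel_comb_shift f c d u y :
  kernel_comb f (shift c u) (y + d)%C
    = kernel_comb f (shift (c - Cconj d) u) y.
Proof.
  induction u as [|p u IH]; simpl; [|rewrite IH, Cplus_conj]; trivial.
  f_equal. f_equal. f_equal. ring.
Qed.

Lemma form_app_l f u u' v :
  form f (u ++ u') v = (form f u v + form f u' v)%C.
Proof.
  unfold form. rewrite <- pairing_plus. apply pairing_ext_all.
  intros; apply kernel_comb_app.
Qed.

Lemma form_app_r f u v v' :
  form f u (v ++ v') = (form f u v + form f u v')%C.
Proof. apply pairing_app. Qed.

Lemma form_scale_l f c u v : form f (scale c u) v = (c * form f u v)%C.
Proof.
  unfold form. rewrite <- pairing_scal. apply pairing_ext_all.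
  intros; apply kernel_comb_scale.
Qed.

Lemma form_scale_r f c u v :
  form f u (scale c v) = (Cconj c * form f u v)%C.
Proof. apply pairing_scale. Qed.

(** The kernel depends on [x - Cconj y] only, so a translation by [d] in the
    second argument can be traded for a translation by [- Cconj d] in the first.
    In particular real translations are isometries, while imaginary ones add up. *)
Lemma form_shift f c d u v :
  form f (shift c u) (shift d v) = form f (shift (c - Cconj d) u) v.
Proof.
  unfold form. rewrite pairing_shift. apply pairing_ext_all.
  intros; apply kernel_comb_shift.
Qed.

Lemma shift_shift c d u : shift c (shift d u) = shift (d + c) u.
Proof.
  unfold shift. rewrite map_map. apply map_ext. intros p. simpl.
  now rewrite Cplus_assoc.
Qed.

Lemma shift_app c u v : shift c (u ++ v) = shift c u ++ shift c v.
Proof. apply map_app. Qed.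

Lemma shift_scale c d u : shift c (scale d u) = scale d (shift c u).
Proof. unfold shift, scale. now rewrite !map_map. Qed.

Lemma shift_0 u : shift 0 u = u.
Proof.
  unfold shift. rewrite <- (map_id u) at 2. apply map_ext.
  intros [a x]; simpl. f_equal. ring.
Qed.

Lemma supported_app P u v :
  supported P u -> supported P v -> supported P (u ++ v).
Proof. intros; apply Forall_app; now split. Qed.

Lemma supported_impl (P Q : C -> Prop) v :
  (forall y, P y -> Q y) -> supported P v -> supported Q v.
Proof. intros H. apply Forall_impl. intros p; apply H. Qed.

Lemma supported_scale P c v : supported P v -> supported P (scale c v).
Proof.
  intros H. apply Forall_map. revert H. apply Forall_impl. trivial.
Qed.

(** * Discs and supports *)

Lemma Cdisc_impl c r r' z : r <= r' -> Cdisc c r z -> Cdisc c r' z.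
Proof. unfold Cdisc; lra. Qed.

Lemma Cdisc_center c r : 0 < r -> Cdisc c r c.
Proof. intros Hr. unfold Cdisc, Cminus. rewrite Cplus_opp_r, Cmod_0. lra. Qed.

Lemma Cdisc_center_plus c r h : Cmod h < r -> Cdisc c r (c + h)%C.
Proof. intros Hh. unfold Cdisc. now replace (c + h - c)%C with h by ring. Qed.

Lemma Cdisc_plus c r r' h z :
  Cmod h <= r' -> Cdisc c r z -> Cdisc c (r + r') (z + h)%C.
Proof.
  unfold Cdisc. intros Hh Hz. replace (z + h - c)%C with ((z - c) + h)%C by ring.
  pose proof (Cmod_triangle (z - c) h). lra.
Qed.

Lemma supported_shift c r r' h v :
  Cmod h <= r' -> supported (Cdisc c r) v ->
  supported (Cdisc c (r + r')) (shift h v).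
Proof.
  intros Hh H. apply Forall_map. revert H. apply Forall_impl.
  intros p; simpl. now apply Cdisc_plus.
Qed.

Lemma Cdisc_convex c r x h s :
  0 <= s <= 1 -> Cdisc c r x -> Cdisc c r (x + h)%C -> Cdisc c r (x + h * s)%C.
Proof.
  unfold Cdisc. intros Hs Hx Hh.
  replace (x + h * s - c)%C with ((1 - s)%R * (x - c) + s * (x + h - c))%C
    by (rewrite RtoC_minus; ring).
  eapply Rle_lt_trans; [apply Cmod_triangle|].
  rewrite !Cmod_mult, !Cmod_R, !Rabs_pos_eq by lra.
  pose proof (Rmax_l (Cmod (x - c)) (Cmod (x + h - c))).
  pose proof (Rmax_r (Cmod (x - c)) (Cmod (x + h - c))).
  pose proof (Rmax_lub_lt _ _ _ Hx Hh). nra.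
Qed.

Lemma Cdisc_codiff c r r' x y :
  Cdisc c r x -> Cdisc c r' y -> Cdisc (c - Cconj c) (r + r') (x - Cconj y)%C.
Proof.
  unfold Cdisc. intros Hx Hy.
  replace (x - Cconj y - (c - Cconj c))%C with ((x - c) + - Cconj (y - c))%C
    by (rewrite Cminus_conj; ring).
  eapply Rle_lt_trans; [apply Cmod_triangle|]. rewrite Cmod_opp, Cmod_conj. lra.
Qed.

Lemma Cmod_Ci_mult (s : R) : Cmod (Ci * s) = Rabs s.
Proof. rewrite Cmod_mult, Cmod_Ci, Cmod_R. ring. Qed.

Lemma supported_delta c r s v :
  0 <= s -> supported (Cdisc c r) v -> supported (Cdisc c (r + s)) (delta s v).
Proof.
  intros Hs H. apply supported_app.
  - apply supported_shift; trivial.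
    rewrite Cmod_Ci_mult, Rabs_pos_eq; lra.
  - apply supported_scale. revert H. apply supported_impl.
    intros y. apply Cdisc_impl; lra.
Qed.

(** * Positivity and the Cauchy-Schwarz inequality *)

Lemma sum_nth (g : C * C -> C) (l : list (C * C)) d :
  sum_n_m (fun i => g (nth (pred i) l d)) 1 (length l)
    = fold_right (fun p a => (g p + a)%C) (RtoC 0) l.
Proof.
  induction l as [|p l IH]; simpl.
  - now rewrite sum_n_m_zero by lia.
  - rewrite sum_Sn_m by lia. simpl. change plus with Cplus. f_equal.
    rewrite <- IH, <- sum_n_m_S.
    destruct l as [|q l]; [now rewrite !sum_n_m_zero by (simpl; lia)|].
    apply sum_n_m_ext_loc. intros [|k] Hk; [lia|reflexivity].
Qed.

Lemma form_fold f u v :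
  form f u v = fold_right (fun p a => (fold_right (fun q b =>
    (f (snd p - Cconj (snd q)) * fst p * Cconj (fst q) + b)%C) (RtoC 0) v + a)%C)
    (RtoC 0) u.
Proof.
  induction u as [|p u IH]; simpl.
  - unfold form. induction v as [|q v IH]; cbn [pairing]; [|rewrite IH; simpl]; ring.
  - rewrite <- IH. change (p :: u) with ([p] ++ u). rewrite form_app_l.
    f_equal. unfold form. clear.
    induction v as [|q v IH]; cbn [pairing fold_right]; trivial.
    rewrite IH. simpl. ring.
Qed.

(** The family of points and coefficients is read off the list, with the index
    lowered by one; the default value of [nth] is never reached. *)
Lemma positive_definite_positive_on Omega f :
  positive_definite_function Omega f -> positive_on Omega f.
Proof.
  intros H v Hv.
  pose (d := (RtoC 0, RtoC 0)).
  specialize (H (length v) (fun j => snd (nth (pred j) v d))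
    (fun j => fst (nth (pred j) v d))).
  rewrite form_fold, <- (sum_nth _ v d).
  erewrite sum_n_m_ext; [apply H|intros i; cbv beta; now rewrite <- (sum_nth _ v d)].
  intros j Hj. apply (proj1 (Forall_forall (fun p => Omega (snd p)) v)); trivial.
  apply nth_In. lia.
Qed.

Lemma Re_Cmult a b : Re (a * b)%C = Re a * Re b - Im a * Im b.
Proof. reflexivity. Qed.

Lemma Im_Cmult a b : Im (a * b)%C = Re a * Im b + Im a * Re b.
Proof. reflexivity. Qed.

Lemma Cmod_sqr z : Cmod z ^ 2 = Re z ^ 2 + Im z ^ 2.
Proof. apply Cmod2_alt. Qed.

Lemma sqnorm_ge_0 P f v : positive_on P f -> supported P v -> 0 <= sqnorm f v.
Proof. intros H Hv. apply (H v Hv). Qed.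

(** The test values [t] differ: the minimiser [1 / c] when [c] is positive, and
    one that makes the affine function negative when [c = 0]. *)
Lemma discriminant_bound a b c :
  0 <= a -> 0 <= b -> 0 <= c ->
  (forall t, 0 <= a - 2 * t * b + t ^ 2 * (b * c)) -> b <= a * c.
Proof.
  intros Ha Hb Hc H.
  destruct (Req_dec b 0) as [->|Hb0]; [nra|].
  destruct (Req_dec c 0) as [->|Hc0].
  - specialize (H ((a + 1) / b)).
    replace (a - 2 * ((a + 1) / b) * b + ((a + 1) / b) ^ 2 * (b * 0))
      with (- a - 2) in H by (field; lra). lra.
  - specialize (H (/ c)).
    replace (a - 2 * / c * b + (/ c) ^ 2 * (b * c)) with ((a * c - b) / c) in H
      by (field; lra).
    assert (0 <= (a * c - b) / c * c) by (apply Rmult_le_pos; lra).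
    replace ((a * c - b) / c * c) with (a * c - b) in H0 by (field; lra). lra.
Qed.

Lemma form_add_scale f c u v :
  form f (u ++ scale c v) (u ++ scale c v)
    = (form f u u + Cconj c * form f u v + c * form f v u
       + c * Cconj c * form f v v)%C.
Proof.
  rewrite form_app_l, !form_app_r, !form_scale_l, !form_scale_r. ring.
Qed.

(** Polarisation: the form is real at [u + v] and at [u + i v]. *)
Lemma form_hermitian P f u v :
  positive_on P f -> supported P u -> supported P v ->
  form f v u = Cconj (form f u v).
Proof.
  intros H Hu Hv.
  assert (Huu := proj1 (H u Hu)). assert (Hvv := proj1 (H v Hv)).
  assert (Hc : forall c, Im (Cconj c * form f u v + c * form f v u) = 0).
  { intros c.
    assert (Hs : supported P (u ++ scale c v))
      by (apply supported_app; trivial; now apply supported_scale).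
    apply H in Hs. destruct Hs as [Hs _]. rewrite form_add_scale in Hs.
    rewrite !im_plus, !Im_Cmult, ?Re_Cmult, ?re_conj, ?im_conj in *.
    rewrite Huu, Hvv in Hs. nra. }
  pose proof (Hc 1) as H1. pose proof (Hc Ci) as Hi.
  rewrite !im_plus, !Im_Cmult, !re_conj, !im_conj in H1, Hi. simpl in H1, Hi.
  apply injective_projections; simpl; unfold Re, Im in *; lra.
Qed.

(** Positivity at [u - t <u, v> v] for every real [t] makes the discriminant of
    a real quadratic polynomial nonpositive. *)
Lemma form_cauchy_schwarz P f u v :
  positive_on P f -> supported P u -> supported P v ->
  Cmod (form f u v) ^ 2 <= sqnorm f u * sqnorm f v.
Proof.
  intros H Hu Hv.
  apply discriminant_bound; try (eapply sqnorm_ge_0; eassumption).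
  { apply pow2_ge_0. }
  intros t.
  assert (Hs : supported P (u ++ scale (- t * form f u v) v))
    by (apply supported_app; trivial; now apply supported_scale).
  apply H in Hs. destruct Hs as [_ Hs]. rewrite form_add_scale in Hs.
  rewrite (form_hermitian P f u v H Hu Hv) in Hs.
  assert (Hvv := proj1 (H v Hv)).
  unfold sqnorm. rewrite Cmod_sqr.
  rewrite !re_plus, !Re_Cmult, ?Cmult_conj, ?Re_Cmult, ?Im_Cmult in Hs.
  rewrite ?re_conj, ?im_conj, ?Copp_conj, ?re_opp, ?im_opp in Hs.
  simpl in Hs. rewrite Hvv in Hs. unfold Re, Im in *.
  match type of Hs with
  | 0 <= ?y => match goal with |- 0 <= ?x => replace x with y by ring end
  end.
  exact Hs.
Qed.

(** * Second-order bounds from positivity *)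

(** For a single point [x] this is the real part of [f] along the vertical line
    through [x - Cconj x].  In general [autocorr f u (a + b)] is the inner product
    of [u] moved up by [a] with [u] moved up by [b]. *)
Definition autocorr (f : C -> C) (u : list (C * C)) (tau : R) : R :=
  Re (form f (shift (Ci * tau) u) u).

Lemma Cconj_Ci_mult (s : R) : Cconj (Ci * s) = (- (Ci * s))%C.
Proof. apply injective_projections; simpl; ring. Qed.

Lemma form_shift_imag f (a b : R) u v :
  form f (shift (Ci * a) u) (shift (Ci * b) v)
    = form f (shift (Ci * (a + b)%R) u) v.
Proof.
  rewrite form_shift, Cconj_Ci_mult. f_equal. f_equal. rewrite RtoC_plus. ring.
Qed.

Lemma autocorr_0 f u : autocorr f u 0 = sqnorm f u.
Proof. unfold autocorr. now rewrite Cmult_0_r, shift_0. Qed.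

Lemma autocorr_shift f u (sigma tau : R) :
  autocorr f (shift (Ci * sigma) u) tau = autocorr f u (tau + 2 * sigma).
Proof.
  unfold autocorr. rewrite shift_shift, <- Cmult_plus_distr_l, <- RtoC_plus.
  rewrite form_shift_imag. do 4 f_equal. f_equal. ring.
Qed.

(** The form sees the two differences as one second difference, because
    imaginary translations of both arguments add up. *)
Lemma autocorr_delta f u s tau :
  autocorr f (delta s u) tau
    = autocorr f u (tau + 2 * s) - 2 * autocorr f u (tau + s)
      + autocorr f u tau.
Proof.
  unfold autocorr, delta.
  rewrite shift_app, shift_scale, shift_shift, <- Cmult_plus_distr_l, <- RtoC_plus.
  rewrite form_app_l, !form_app_r, !form_scale_l, !form_scale_r.
  rewrite !form_shift_imag.
  replace (s + tau + s) with (tau + 2 * s) by ring.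
  replace (s + tau) with (tau + s) by ring.
  rewrite !re_plus, !Re_Cmult. simpl. ring.
Qed.

(** Convexity of the autocorrelation about [0]: the difference of the two sides
    is the squared norm of the combination [u] moved up by [sigma / 2] minus [u]
    moved down by [sigma / 2]. *)
Lemma autocorr_midpoint f (c : C) r r1 u sigma :
  positive_on (Cdisc c r1) f -> supported (Cdisc c r) u ->
  r + Rabs sigma / 2 <= r1 ->
  2 * sqnorm f u <= autocorr f u sigma + autocorr f u (- sigma).
Proof.
  intros Hpos Hu Hr.
  assert (Hsup : forall a, Rabs a <= Rabs sigma / 2 ->
    supported (Cdisc c r1) (shift (Ci * a) u)).
  { intros a Ha. apply (supported_impl (Cdisc c (r + Rabs sigma / 2))).
    - intros y. now apply Cdisc_impl.
    - apply supported_shift; trivial. now rewrite Cmod_Ci_mult. }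
  assert (Hv := sqnorm_ge_0 _ f (shift (Ci * (sigma / 2)%R) u
    ++ scale (-1) (shift (Ci * (- sigma / 2)%R) u)) Hpos).
  assert (Habs : forall a, Rabs (a / 2) = Rabs a / 2).
  { intros a. unfold Rdiv. rewrite Rabs_mult, (Rabs_pos_eq (/ 2)); lra. }
  unfold sqnorm in *.
  rewrite form_app_l, !form_app_r, !form_scale_l, !form_scale_r in Hv.
  rewrite !form_shift_imag in Hv.
  replace (sigma / 2 + sigma / 2) with sigma in Hv by field.
  replace (- sigma / 2 + - sigma / 2) with (- sigma) in Hv by field.
  replace (sigma / 2 + - sigma / 2) with 0 in Hv by field.
  replace (- sigma / 2 + sigma / 2) with 0 in Hv by field.
  rewrite Cmult_0_r, shift_0 in Hv.
  rewrite !re_plus, !Re_Cmult in Hv. simpl in Hv.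
  unfold autocorr.
  enough (0 <= Re (form f (shift (Ci * sigma) u) u) +
    Re (form f (shift (Ci * (- sigma)%R) u) u) - 2 * Re (form f u u)) by lra.
  eapply Rle_trans; [apply Hv|right; unfold Re, Im; ring].
  apply supported_app; [|apply supported_scale]; apply Hsup; rewrite Habs, ?Rabs_Ropp; lra.
Qed.

(** Discrete Taylor inequality for a sequence that starts like an even one, which
    is why the first increment needs only half of the bound on second differences. *)
Lemma quadratic_growth (c : nat -> R) m n :
  c 0%nat + m <= c 1%nat ->
  (forall k, (k + 2 <= n)%nat -> 2 * m <= c (S (S k)) - 2 * c (S k) + c k) ->
  c 0%nat + INR n ^ 2 * m <= c n.
Proof.
  intros H0 H.
  assert (Hd : forall k, (k < n)%nat -> (2 * INR k + 1) * m <= c (S k) - c k).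
  { induction k as [|k IH]; intros Hk; [simpl; lra|].
    specialize (IH ltac:(lia)). specialize (H k ltac:(lia)).
    rewrite S_INR. lra. }
  clear H0 H. induction n as [|n IH]; [simpl; lra|].
  specialize (IH ltac:(intros; apply Hd; lia)). specialize (Hd n ltac:(lia)).
  rewrite S_INR. lra.
Qed.

(** The sum of the values of [autocorr f u] at [s + k s] and [s - k s] has second
    difference [autocorr f (delta s u) (k s) + autocorr f (delta s u) (- k s)] in
    [k], and by convexity this is at least [2 * sqnorm f (delta s u)].  So the
    sequence grows at least quadratically. *)
Lemma sqnorm_delta_le f (c : C) r r1 u s n :
  positive_on (Cdisc c r1) f -> supported (Cdisc c r) u -> 0 <= s ->
  r + s + INR n * s <= r1 ->
  INR n ^ 2 * sqnorm f (delta s u)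
    <= autocorr f u (s + INR n * s) + autocorr f u (s - INR n * s)
       - 2 * autocorr f u s.
Proof.
  intros Hpos Hu Hs Hr.
  pose (a := fun k : nat => autocorr f u (s + INR k * s) + autocorr f u (s - INR k * s)).
  enough (a 0%nat + INR n ^ 2 * sqnorm f (delta s u) <= a n).
  { unfold a in H. simpl INR in H at 1 2. rewrite Rmult_0_l in H.
    rewrite Rplus_0_r, Rminus_0_r in H. lra. }
  apply quadratic_growth; unfold a.
  - rewrite <- autocorr_0, autocorr_delta. simpl.
    replace (s + 0 * s) with s by ring. replace (s - 0 * s) with s by ring.
    replace (s + 1 * s) with (0 + 2 * s) by ring. replace (s - 1 * s) with 0 by ring.
    replace (0 + s) with s by ring. lra.
  - intros k Hk.
    pose (sigma := (INR k + 1) * s).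
    assert (Hsig : 0 <= sigma) by (apply Rmult_le_pos; [pose proof (pos_INR k)|]; lra).
    eapply Rle_trans.
    + apply (autocorr_midpoint f c (r + s) r1 (delta s u) sigma Hpos).
      * now apply supported_delta.
      * rewrite Rabs_pos_eq by trivial.
        apply le_INR in Hk. rewrite plus_INR in Hk. simpl in Hk.
        unfold sigma in *. nra.
    + rewrite !autocorr_delta, !S_INR. unfold sigma. right.
      replace ((INR k + 1) * s + 2 * s) with (s + (INR k + 1 + 1) * s) by ring.
      replace ((INR k + 1) * s + s) with (s + (INR k + 1) * s) by ring.
      replace ((INR k + 1) * s) with (s + INR k * s) by ring.
      replace (- (s + INR k * s) + 2 * s) with (s - INR k * s) by ring.
      replace (- (s + INR k * s) + s) with (s - (s + INR k * s)) by ring.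
      replace (- (s + INR k * s)) with (s - (INR k + 1 + 1) * s) by ring.
      ring.
Qed.

(** With [n s] of fixed size this says that a bounded autocorrelation forces
    [delta s u] to have norm of order [s]. *)
Lemma sqnorm_delta_le_bound f (c : C) r r1 u s n A :
  positive_on (Cdisc c r1) f -> supported (Cdisc c r) u -> 0 <= s ->
  r + s + INR n * s <= r1 ->
  (forall tau, Rabs tau <= s + INR n * s -> Rabs (autocorr f u tau) <= A) ->
  INR n ^ 2 * sqnorm f (delta s u) <= 4 * A.
Proof.
  intros Hpos Hu Hs Hr HA.
  pose proof (sqnorm_delta_le f c r r1 u s n Hpos Hu Hs Hr).
  assert (Hn : 0 <= INR n * s) by (apply Rmult_le_pos; [apply pos_INR|lra]).
  assert (H1 := HA (s + INR n * s) ltac:(apply Rabs_le; lra)).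
  assert (H2 := HA (s - INR n * s) ltac:(apply Rabs_le; lra)).
  assert (H3 := HA s ltac:(apply Rabs_le; lra)).
  apply Rabs_le_between in H1, H2, H3. lra.
Qed.

Lemma shift_delta c s u : shift c (delta s u) = delta s (shift c u).
Proof.
  unfold delta. rewrite shift_app, shift_scale, !shift_shift.
  now rewrite (Cplus_comm c).
Qed.

Lemma autocorr_point f (x : C) (tau : R) :
  autocorr f [(RtoC 1, x)] tau = Re (f (x - Cconj x + Ci * tau)%C).
Proof.
  unfold autocorr, form. cbn [shift map pairing kernel_comb fst snd].
  replace (x + Ci * tau - Cconj x)%C with (x - Cconj x + Ci * tau)%C by ring.
  rewrite !re_plus, !Re_Cmult, !im_plus, ?Im_Cmult. simpl. unfold Re, Im; simpl. ring.
Qed.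

(** The bound on second differences of positive type is used twice: for the single
    point it turns the bound on [f] into a bound on [delta t], uniformly over
    points near [x0]; that is a bound on the autocorrelation of [delta t], which
    in turn controls [delta s] of it.  The steps are of the form [rho / n], so that
    [n] of them cover a fixed length. *)
Lemma sqnorm_delta_delta_le f x0 rho M x n m :
  positive_on (Cdisc x0 (8 * rho)) f ->
  (forall z, Cdisc (x0 - Cconj x0) (16 * rho) z -> Cmod (f z) <= M) ->
  (0 < n)%nat -> (0 < m)%nat -> 0 < rho ->
  Cdisc x0 (2 * rho) x ->
  sqnorm f (delta (rho / INR n) (delta (rho / INR m) [(RtoC 1, x)]))
    <= 16 * M / (INR n ^ 2 * INR m ^ 2).
Proof.
  intros Hpos HM Hn Hm Hrho Hx.
  assert (Hst : forall k, (0 < k)%nat ->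
    1 <= INR k /\ 0 < rho / INR k /\ rho / INR k <= rho /\ INR k * (rho / INR k) = rho).
  { intros k Hk. assert (H1 : 1 <= INR k) by (change 1 with (INR 1); apply le_INR; lia).
    assert (H2 : INR k * (rho / INR k) = rho) by (field; lra).
    assert (H3 : 0 < rho / INR k) by (apply Rdiv_lt_0_compat; lra).
    repeat split; trivial. nra. }
  destruct (Hst n Hn) as (Hn1 & Hs0 & Hs1 & Hns).
  destruct (Hst m Hm) as (Hm1 & Ht0 & Ht1 & Hmt). clear Hst.
  set (s := rho / INR n) in *. set (t := rho / INR m) in *.
  assert (Hone : forall y, Cdisc x0 (3 * rho) y ->
    INR m ^ 2 * sqnorm f (delta t [(RtoC 1, y)]) <= 4 * M).
  { intros y Hy. apply (sqnorm_delta_le_bound f x0 (3 * rho) (8 * rho)); trivial; try lra.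
    { now repeat constructor. }
    intros tau Htau. rewrite autocorr_point. eapply Rle_trans; [apply re_le_Cmod|].
    apply HM. unfold Cdisc in *.
    replace (y - Cconj y + Ci * tau - (x0 - Cconj x0))%C
      with ((y - x0) + (- Cconj (y - x0)) + Ci * tau)%C
      by (rewrite Cminus_conj; ring).
    pose proof (Cmod_triangle ((y - x0) + (- Cconj (y - x0))) (Ci * tau)) as T1.
    pose proof (Cmod_triangle (y - x0) (- Cconj (y - x0))) as T2.
    rewrite Cmod_opp, Cmod_conj in T2. rewrite Cmod_Ci_mult in T1. lra. }
  assert (Htwo : INR n ^ 2 * sqnorm f (delta s (delta t [(RtoC 1, x)]))
    <= 4 * (4 * M / INR m ^ 2)).
  { apply (sqnorm_delta_le_bound f x0 (3 * rho) (8 * rho)); trivial; try lra.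
    { apply (supported_impl (Cdisc x0 (2 * rho + t))).
      - intros y; apply Cdisc_impl; lra.
      - apply supported_delta; [lra|]. now repeat constructor. }
    intros tau Htau.
    (* The autocorrelation at [tau] is the squared norm after moving up by [tau / 2]. *)
    replace tau with (0 + 2 * (tau / 2)) by field.
    rewrite <- autocorr_shift, autocorr_0, shift_delta.
    assert (Hy : Cdisc x0 (3 * rho) (x + Ci * (tau / 2)%R)%C).
    { replace (3 * rho) with (2 * rho + rho) by ring. apply Cdisc_plus; trivial.
      rewrite Cmod_Ci_mult. unfold Rdiv. rewrite Rabs_mult, (Rabs_pos_eq (/ 2)); lra. }
    specialize (Hone _ Hy). change (shift (Ci * (tau / 2)%R) [(RtoC 1, x)])
      with [(RtoC 1, (x + Ci * (tau / 2)%R)%C)].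
    rewrite Rabs_pos_eq.
    - apply (Rmult_le_reg_l (INR m ^ 2)); [nra|].
      replace (INR m ^ 2 * (4 * M / INR m ^ 2)) with (4 * M) by (field; lra). trivial.
    - apply (sqnorm_ge_0 (Cdisc x0 (8 * rho))); trivial.
      apply (supported_impl (Cdisc x0 (3 * rho + t))).
      + intros y; apply Cdisc_impl; lra.
      + apply supported_delta; [lra|]. now repeat constructor. }
  apply (Rmult_le_reg_l (INR n ^ 2)); [nra|].
  replace (INR n ^ 2 * (16 * M / (INR n ^ 2 * INR m ^ 2))) with (4 * (4 * M / INR m ^ 2))
    by (field; lra). trivial.
Qed.

(** * Dual norms, limits and mean values *)

(** A dual norm.  Unlike [sqnorm] it makes sense for functions that are not finite
    combinations, such as derivatives of the kernel, and it passes to pointwise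
    limits. *)
Definition dual_le (f : C -> C) (P : C -> Prop) (F : C -> C) (M : R) : Prop :=
  forall v, supported P v -> Cmod (pairing F v) <= M * sqrt (sqnorm f v).

Lemma dual_le_ext f P F G M :
  (forall y, P y -> F y = G y) -> dual_le f P F M -> dual_le f P G M.
Proof.
  intros HFG H v Hv. rewrite <- (pairing_ext P F G v HFG Hv). now apply H.
Qed.

Lemma dual_le_weaken f P F M M' : M <= M' -> dual_le f P F M -> dual_le f P F M'.
Proof.
  intros HM H v Hv. eapply Rle_trans; [now apply H|].
  apply Rmult_le_compat_r; [apply sqrt_pos|trivial].
Qed.

Lemma dual_le_plus f P F G M M' :
  dual_le f P F M -> dual_le f P G M' ->
  dual_le f P (fun y => F y + G y)%C (M + M').
Proof.
  intros HF HG v Hv. rewrite pairing_plus.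
  eapply Rle_trans; [apply Cmod_triangle|].
  specialize (HF v Hv). specialize (HG v Hv). lra.
Qed.

Lemma dual_le_scal f P c F M :
  dual_le f P F M -> dual_le f P (fun y => c * F y)%C (Cmod c * M).
Proof.
  intros HF v Hv. rewrite pairing_scal, Cmod_mult, Rmult_assoc.
  apply Rmult_le_compat_l; [apply Cmod_ge_0|now apply HF].
Qed.

Lemma dual_le_kernel_comb f P u :
  positive_on P f -> supported P u ->
  dual_le f P (kernel_comb f u) (sqrt (sqnorm f u)).
Proof.
  intros H Hu v Hv.
  pose proof (form_cauchy_schwarz P f u v H Hu Hv) as HCS.
  rewrite <- sqrt_mult by (eapply sqnorm_ge_0; eassumption).
  rewrite <- (sqrt_pow2 (Cmod _)) by apply Cmod_ge_0. now apply sqrt_le_1_alt.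
Qed.

(** Test [u] against itself: [sqnorm f u <= M * sqrt (sqnorm f u)].  Thus a bound
    tested only on combinations supported in [P] bounds the true norm, and can
    then be used against points outside [P]. *)
Lemma sqnorm_le_dual f P u M : 0 <= M ->
  positive_on P f -> supported P u -> dual_le f P (kernel_comb f u) M ->
  sqrt (sqnorm f u) <= M.
Proof.
  intros HM H Hu Hd.
  assert (H0 := sqnorm_ge_0 P f u H Hu).
  specialize (Hd u Hu). fold (form f u u) in Hd.
  pose proof (Rle_abs (Re (form f u u))).
  pose proof (re_le_Cmod (form f u u)).
  fold (sqnorm f u) in *.
  pose proof (sqrt_sqrt _ H0). pose proof (sqrt_pos (sqnorm f u)). nra.
Qed.

Definition converges (u : nat -> C) (l : C) : Prop :=
  forall eps, 0 < eps -> exists N, forall n, (N <= n)%nat -> Cmod (u n - l) <= eps.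

Lemma converges_pairing (Fn : nat -> C -> C) P F v :
  (forall y, P y -> converges (fun n => Fn n y) (F y)) -> supported P v ->
  converges (fun n => pairing (Fn n) v) (pairing F v).
Proof.
  intros H Hv. induction Hv as [|p v Hp Hv IH]; intros eps Heps; simpl.
  - exists 0%nat. intros n _. unfold Cminus. rewrite Cplus_opp_r, Cmod_0. lra.
  - set (K := Cmod (fst p) + 1).
    assert (HK : 0 < K) by (pose proof (Cmod_ge_0 (fst p)); unfold K; lra).
    destruct (IH (eps / 2) ltac:(lra)) as [N1 HN1].
    destruct (H _ Hp (eps / 2 / K) ltac:(apply Rdiv_lt_0_compat; lra)) as [N2 HN2].
    exists (max N1 N2). intros n Hn.
    specialize (HN1 n ltac:(lia)). specialize (HN2 n ltac:(lia)).
    match goal with |- Cmod ?z <= _ => replace z with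
      (Cconj (fst p) * (Fn n (snd p) - F (snd p)) + (pairing (Fn n) v - pairing F v))%C by ring end.
    eapply Rle_trans; [apply Cmod_triangle|]. rewrite Cmod_mult, Cmod_conj.
    assert (Cmod (fst p) * Cmod (Fn n (snd p) - F (snd p)) <= K * (eps / 2 / K)).
    { apply Rmult_le_compat; try apply Cmod_ge_0; [unfold K; lra|exact HN2]. }
    replace (K * (eps / 2 / K)) with (eps / 2) in H0 by (field; lra). lra.
Qed.

Lemma dual_le_limit f P Fn F M :
  (forall y, P y -> converges (fun n => Fn n y) (F y)) ->
  (forall n, dual_le f P (Fn n) M) -> dual_le f P F M.
Proof.
  intros Hlim H v Hv. apply le_epsilon. intros eps Heps.
  destruct (converges_pairing Fn P F v Hlim Hv eps Heps) as [N HN].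
  specialize (HN N (Nat.le_refl N)). specialize (H N v Hv).
  replace (pairing F v) with (pairing (Fn N) v + - (pairing (Fn N) v - pairing F v))%C by ring.
  eapply Rle_trans; [apply Cmod_triangle|]. rewrite Cmod_opp. lra.
Qed.

Lemma converges_ext (u v : nat -> C) l :
  (forall n, u n = v n) -> converges u l -> converges v l.
Proof.
  intros E H eps Heps. destruct (H eps Heps) as [N HN]. exists N.
  intros n Hn. rewrite <- E. auto.
Qed.

Lemma converges_plus u v l l' :
  converges u l -> converges v l' -> converges (fun n => u n + v n)%C (l + l')%C.
Proof.
  intros Hu Hv eps Heps.
  destruct (Hu (eps / 2) ltac:(lra)) as [N1 HN1].
  destruct (Hv (eps / 2) ltac:(lra)) as [N2 HN2].
  exists (max N1 N2). intros n Hn.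
  specialize (HN1 n ltac:(lia)). specialize (HN2 n ltac:(lia)).
  replace (u n + v n - (l + l'))%C with ((u n - l) + (v n - l'))%C by ring.
  eapply Rle_trans; [apply Cmod_triangle|]. lra.
Qed.

Lemma converges_scal c u l : converges u l -> converges (fun n => c * u n)%C (c * l)%C.
Proof.
  intros Hu eps Heps.
  assert (HK : 0 < Cmod c + 1) by (pose proof (Cmod_ge_0 c); lra).
  destruct (Hu (eps / (Cmod c + 1)) ltac:(apply Rdiv_lt_0_compat; lra)) as [N HN].
  exists N. intros n Hn. specialize (HN n Hn).
  replace (c * u n - c * l)%C with (c * (u n - l))%C by ring. rewrite Cmod_mult.
  assert (Cmod c * Cmod (u n - l) <= (Cmod c + 1) * (eps / (Cmod c + 1))).
  { apply Rmult_le_compat; try apply Cmod_ge_0; lra. }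
  replace ((Cmod c + 1) * (eps / (Cmod c + 1))) with eps in H by (field; lra). lra.
Qed.

(** * Derivatives along real paths *)

(** Both derivatives are stated with explicit bounds in [Cmod], the norm in which
    all estimates are made; the second one has a real variable and complex
    values. *)
Definition has_Cderiv (f : C -> C) (z l : C) : Prop :=
  forall eps, 0 < eps -> exists delta, 0 < delta /\
    forall h, Cmod h < delta -> Cmod (f (z + h)%C - f z - h * l) <= eps * Cmod h.

Definition path_deriv (u : R -> C) (s : R) (l : C) : Prop :=
  forall eps, 0 < eps -> exists delta, 0 < delta /\
    forall k, Rabs k < delta -> Cmod (u (s + k) - u s - k * l) <= eps * Rabs k.

Lemma path_deriv_ext u v s l :
  (forall t, u t = v t) -> path_deriv u s l -> path_deriv v s l.
Proof.
  intros E H eps Heps. destruct (H eps Heps) as (d & Hd & H'). exists d.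
  split; trivial. intros k Hk. rewrite <- !E. auto.
Qed.

Lemma path_deriv_plus u v s l l' :
  path_deriv u s l -> path_deriv v s l' ->
  path_deriv (fun t => u t + v t)%C s (l + l')%C.
Proof.
  intros Hu Hv eps Heps.
  destruct (Hu (eps / 2) ltac:(lra)) as (d1 & Hd1 & H1).
  destruct (Hv (eps / 2) ltac:(lra)) as (d2 & Hd2 & H2).
  exists (Rmin d1 d2). split; [now apply Rmin_pos|]. intros k Hk.
  specialize (H1 k ltac:(pose proof (Rmin_l d1 d2); lra)).
  specialize (H2 k ltac:(pose proof (Rmin_r d1 d2); lra)).
  match goal with |- Cmod ?z <= _ => replace z with
    ((u (s + k)%R - u s - k * l) + (v (s + k)%R - v s - k * l'))%C by ring end.
  eapply Rle_trans; [apply Cmod_triangle|]. lra.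
Qed.

Lemma path_deriv_scal c u s l :
  path_deriv u s l -> path_deriv (fun t => c * u t)%C s (c * l)%C.
Proof.
  intros Hu eps Heps.
  assert (HK : 0 < Cmod c + 1) by (pose proof (Cmod_ge_0 c); lra).
  destruct (Hu (eps / (Cmod c + 1)) ltac:(apply Rdiv_lt_0_compat; lra)) as (d & Hd & H).
  exists d. split; trivial. intros k Hk. specialize (H k Hk).
  replace (c * u (s + k)%R - c * u s - k * (c * l))%C
    with (c * (u (s + k)%R - u s - k * l))%C by ring. rewrite Cmod_mult.
  assert (Cmod c * Cmod (u (s + k)%R - u s - k * l)
    <= (Cmod c + 1) * (eps / (Cmod c + 1) * Rabs k)).
  { apply Rmult_le_compat; try apply Cmod_ge_0; lra. }
  replace ((Cmod c + 1) * (eps / (Cmod c + 1) * Rabs k)) with (eps * Rabs k) in H0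
    by (field; lra). lra.
Qed.

Lemma path_deriv_linear (c : C) s : path_deriv (fun t => c * t)%C s c.
Proof.
  intros eps Heps. exists 1. split; [lra|]. intros k _.
  replace (c * (s + k)%R - c * s - k * c)%C with (RtoC 0) by (rewrite RtoC_plus; ring).
  rewrite Cmod_0. apply Rmult_le_pos; [lra|apply Rabs_pos].
Qed.

Lemma path_deriv_segment f a h (s : R) l :
  has_Cderiv f (a + h * s)%C l -> path_deriv (fun t => f (a + h * t)%C) s (h * l)%C.
Proof.
  intros Hf eps Heps.
  assert (HK : 0 < Cmod h + 1) by (pose proof (Cmod_ge_0 h); lra).
  destruct (Hf (eps / (Cmod h + 1)) ltac:(apply Rdiv_lt_0_compat; lra)) as (d & Hd & H).
  exists (d / (Cmod h + 1)). split; [apply Rdiv_lt_0_compat; lra|]. intros k Hk.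
  assert (Hkd : (Cmod h + 1) * Rabs k < d).
  { apply (Rmult_lt_compat_l (Cmod h + 1)) in Hk; trivial.
    replace ((Cmod h + 1) * (d / (Cmod h + 1))) with d in Hk by (field; lra). trivial. }
  assert (Hhk : Cmod (h * k) <= (Cmod h + 1) * Rabs k).
  { rewrite Cmod_mult, Cmod_R. apply Rmult_le_compat_r; [apply Rabs_pos|lra]. }
  specialize (H (h * k)%C ltac:(lra)).
  replace (a + h * (s + k)%R)%C with (a + h * s + h * k)%C by (rewrite RtoC_plus; ring).
  replace (k * (h * l))%C with (h * k * l)%C by ring.
  eapply Rle_trans; [apply H|].
  replace (eps * Rabs k) with (eps / (Cmod h + 1) * ((Cmod h + 1) * Rabs k)) by (field; lra).
  apply Rmult_le_compat_l; trivial. left; apply Rdiv_lt_0_compat; lra.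
Qed.

Lemma path_deriv_pairing (F : R -> C -> C) P G s v :
  (forall y, P y -> path_deriv (fun t => F t y) s (G y)) -> supported P v ->
  path_deriv (fun t => pairing (F t) v) s (pairing G v).
Proof.
  intros H Hv. induction Hv as [|p v Hp Hv IH]; simpl.
  - intros eps Heps. exists 1. split; [lra|]. intros k _.
    replace (0 - 0 - k * 0)%C with (RtoC 0) by ring. rewrite Cmod_0.
    apply Rmult_le_pos; [lra|apply Rabs_pos].
  - apply path_deriv_plus; trivial. apply path_deriv_scal. now apply H.
Qed.

(** The real mean value theorem for the component of [u] in the direction of
    [u 1 - u 0]. *)
Lemma path_mean_value (u du : R -> C) M :
  (forall s, 0 <= s <= 1 -> path_deriv u s (du s)) ->
  (forall s, 0 <= s <= 1 -> Cmod (du s) <= M) ->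
  Cmod (u 1 - u 0) <= M.
Proof.
  intros Hd HM.
  set (theta := Cconj (u 1 - u 0)).
  destruct (MVT_cor2 (fun s => Re (theta * u s)) (fun s => Re (theta * du s)) 0 1)
    as (c & Hc & Hc01); [lra| |].
  - intros s Hs eps Heps.
    destruct (path_deriv_scal theta _ _ _ (Hd s Hs) (eps / 2) ltac:(lra))
      as (d & Hd0 & H).
    exists (mkposreal d Hd0). intros k Hk0 Hk. simpl in Hk. specialize (H k Hk).
    replace ((Re (theta * u (s + k)) - Re (theta * u s)) / k - Re (theta * du s))
      with (Re (theta * u (s + k)%R - theta * u s - k * (theta * du s)) / k)
      by (simpl; field; trivial).
    unfold Rdiv. rewrite Rabs_mult, Rabs_inv.
    apply Rabs_pos_lt in Hk0.
    apply (Rmult_lt_reg_r (Rabs k)); trivial.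
    rewrite Rmult_assoc, Rinv_l, Rmult_1_r by lra.
    eapply Rle_lt_trans; [apply re_le_Cmod|]. nra.
  - assert (Hsq : Cmod (u 1 - u 0) ^ 2 <= Cmod (u 1 - u 0) * M).
    { replace (Cmod (u 1 - u 0) ^ 2) with (Re (theta * u 1) - Re (theta * u 0)).
      - rewrite Hc, Rminus_0_r, Rmult_1_r.
        eapply Rle_trans; [apply Rle_abs|]. eapply Rle_trans; [apply re_le_Cmod|].
        rewrite Cmod_mult. unfold theta. rewrite Cmod_conj.
        apply Rmult_le_compat_l; [apply Cmod_ge_0|]. apply HM; lra.
      - rewrite Cmod_sqr. unfold theta. simpl. unfold Re, Im. simpl. ring. }
    pose proof (Cmod_ge_0 (u 1 - u 0)). specialize (HM 0 ltac:(lra)).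
    pose proof (Cmod_ge_0 (du 0)). nra.
Qed.

(** For each fixed test combination the pairing is a complex-valued function of
    one real variable, so a pointwise derivative is enough to obtain a mean value
    inequality in norm. *)
Lemma dual_le_mean_value f P (F G : R -> C -> C) M :
  (forall s, 0 <= s <= 1 -> forall y, P y -> path_deriv (fun t => F t y) s (G s y)) ->
  (forall s, 0 <= s <= 1 -> dual_le f P (G s) M) ->
  dual_le f P (fun y => F 1 y - F 0 y)%C M.
Proof.
  intros Hd HM v Hv.
  replace (pairing (fun y => F 1 y - F 0 y)%C v)
    with (pairing (F 1) v - pairing (F 0) v)%C.
  - apply (path_mean_value (fun s => pairing (F s) v) (fun s => pairing (G s) v)).
    + intros s Hs. apply (path_deriv_pairing _ P); auto.
    + intros s Hs. now apply HM.
  - rewrite (pairing_ext_all (fun y => F 1 y - F 0 y)%C (fun y => F 1 y + - (1) * F 0 y)%C)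
      by (intros; ring).
    rewrite pairing_plus, pairing_scal. ring.
Qed.

(** * Strong differentiability near the diagonal *)

Definition diffq (f : C -> C) (t : R) (z : C) : C :=
  ((f (z + Ci * t)%C - f z) / (Ci * t))%C.

Lemma RtoC_neq (t : R) : t <> 0 -> RtoC t <> 0.
Proof. intros Ht H. apply Ht. now apply RtoC_inj. Qed.

Lemma Ci_mult_neq_0 (t : R) : t <> 0 -> (Ci * t)%C <> 0.
Proof. intros Ht. apply Cmult_neq_0; [apply Ci_nz|now apply RtoC_neq]. Qed.

Lemma diffq_swap f s t z :
  s <> 0 -> t <> 0 ->
  diffq (diffq f s) t z = diffq (diffq f t) s z.
Proof.
  intros Hs Ht. unfold diffq.
  replace (z + Ci * t + Ci * s)%C with (z + Ci * s + Ci * t)%C by ring.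
  field. repeat split; try apply Ci_nz; now apply RtoC_neq.
Qed.

Lemma diffq_diffq_kernel_comb f (s t : R) x y :
  s <> 0 -> t <> 0 ->
  diffq (diffq f t) s (x - Cconj y)%C
    = (/ (Ci * s) * / (Ci * t)
       * kernel_comb f (delta s (delta t [(RtoC 1, x)])) y)%C.
Proof.
  intros Hs Ht. unfold diffq, delta.
  cbn [shift scale map app kernel_comb fst snd].
  replace (x + Ci * t + Ci * s - Cconj y)%C with (x - Cconj y + Ci * s + Ci * t)%C by ring.
  replace (x + Ci * s - Cconj y)%C with (x - Cconj y + Ci * s)%C by ring.
  replace (x + Ci * t - Cconj y)%C with (x - Cconj y + Ci * t)%C by ring.
  replace (RtoC (-1)) with (- (1))%C by (rewrite <- RtoC_opp; reflexivity).
  field. repeat split; try apply Ci_nz; now apply RtoC_neq.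
Qed.

Lemma div_INR_S_pos rho n : 0 < rho -> 0 < rho / INR (S n).
Proof. intros H. apply Rdiv_lt_0_compat; trivial. apply lt_0_INR; lia. Qed.

Lemma div_INR_S_le rho n : 0 < rho -> rho / INR (S n) <= rho.
Proof.
  intros H. assert (1 <= INR (S n)) by (change 1 with (INR 1); apply le_INR; lia).
  assert (0 < rho / INR (S n)) by (now apply div_INR_S_pos).
  assert (rho / INR (S n) * INR (S n) = rho) by (field; lra). nra.
Qed.

Lemma div_INR_S_small rho eps : 0 < rho -> 0 < eps ->
  exists N, forall n, (N <= n)%nat -> rho / INR (S n) < eps.
Proof.
  intros Hr He. destruct (nfloor_ex (rho / eps)) as [N HN].
  { left. now apply Rdiv_lt_0_compat. }
  exists N. intros n Hn. apply le_INR in Hn.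
  assert (0 < INR (S n)) by (apply lt_0_INR; lia). rewrite S_INR in *.
  apply (Rmult_lt_reg_r (INR n + 1)); trivial.
  replace (rho / (INR n + 1) * (INR n + 1)) with rho by (field; lra).
  replace rho with (eps * (rho / eps)) by (field; lra).
  apply Rmult_lt_compat_l; lra.
Qed.

Lemma converges_diffq f z l rho :
  0 < rho -> has_Cderiv f z l ->
  converges (fun n => diffq f (rho / INR (S n)) z) l.
Proof.
  intros Hr Hf eps Heps. destruct (Hf eps Heps) as (d & Hd & H).
  destruct (div_INR_S_small rho d Hr Hd) as [N HN].
  exists N. intros n Hn. specialize (HN n Hn).
  assert (Ht := div_INR_S_pos rho n Hr). set (t := rho / INR (S n)) in *.
  assert (HCt : Cmod (Ci * t) = t) by (rewrite Cmod_Ci_mult, Rabs_pos_eq; lra).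
  specialize (H (Ci * t)%C). rewrite HCt in H. specialize (H HN).
  assert (Hnz : (Ci * t)%C <> 0) by (apply Ci_mult_neq_0; lra).
  replace (diffq f t z - l)%C with ((f (z + Ci * t)%C - f z - Ci * t * l) / (Ci * t))%C.
  - rewrite Cmod_div, HCt by trivial. apply (Rmult_le_reg_r t); trivial.
    unfold Rdiv. rewrite Rmult_assoc, Rinv_l; lra.
  - unfold diffq. field. split; [apply RtoC_neq; lra|apply Ci_nz].
Qed.

(** If [x] and [y] are within [2 rho] and [8 rho] of [x0], and [h] is at most [rho],
    then [x - Cconj y + h] is within [11 rho] of [x0 - Cconj x0]; this is the room that
    the radii leave for [f] and its derivative [df]. *)
Section NearDiagonal.

Context (f df : C -> C) (x0 : C) (rho M : R).
Context (rho_pos : 0 < rho)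
  (f_pos : positive_on (Cdisc x0 (8 * rho)) f)
  (f_bound : forall z, Cdisc (x0 - Cconj x0) (16 * rho) z -> Cmod (f z) <= M)
  (f_deriv : forall z, Cdisc (x0 - Cconj x0) (16 * rho) z -> has_Cderiv f z (df z)).

Let B := Cdisc x0 (8 * rho).
(* The square root of [16 * M / (n * m) ^ 2], divided by the product
   [rho ^ 2 / (n * m)] of the two steps. *)
Let K := 4 * sqrt M / rho ^ 2.

Lemma bound_nonneg : 0 <= M.
Proof.
  eapply Rle_trans; [apply Cmod_ge_0|apply (f_bound (x0 - Cconj x0)%C)].
  apply Cdisc_center. lra.
Qed.

Lemma K_ge_0 : 0 <= K.
Proof.
  unfold K. apply Rmult_le_pos; [pose proof (sqrt_pos M); lra|].
  left. apply Rinv_0_lt_compat. nra.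
Qed.

Lemma f_deriv_codiff (x y h : C) :
  Cdisc x0 (2 * rho) x -> B y -> Cmod h <= rho ->
  has_Cderiv f (x - Cconj y + h)%C (df (x - Cconj y + h)%C).
Proof.
  intros Hx Hy Hh. apply f_deriv.
  apply (Cdisc_impl _ (2 * rho + 8 * rho + rho)); [lra|].
  apply Cdisc_plus; trivial. now apply Cdisc_codiff.
Qed.

Lemma dual_le_diffq_diffq x n m :
  Cdisc x0 (2 * rho) x ->
  dual_le f B (fun y =>
    diffq (diffq f (rho / INR (S m))) (rho / INR (S n)) (x - Cconj y)%C) K.
Proof.
  intros Hx.
  assert (Hn : 0 < INR (S n)) by (apply lt_0_INR; lia).
  assert (Hm : 0 < INR (S m)) by (apply lt_0_INR; lia).
  assert (Hs := div_INR_S_pos rho n rho_pos). assert (Ht := div_INR_S_pos rho m rho_pos).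
  assert (Hs1 := div_INR_S_le rho n rho_pos). assert (Ht1 := div_INR_S_le rho m rho_pos).
  assert (Hq := sqnorm_delta_delta_le f x0 rho M x (S n) (S m) f_pos f_bound
    ltac:(lia) ltac:(lia) rho_pos Hx).
  set (N := INR (S n)) in *. set (N' := INR (S m)) in *.
  set (s := rho / N) in *. set (t := rho / N') in *.
  eapply dual_le_ext.
  { intros y _. symmetry. apply diffq_diffq_kernel_comb; lra. }
  eapply dual_le_weaken.
  2:{ apply dual_le_scal, dual_le_kernel_comb; trivial.
      apply (supported_impl (Cdisc x0 (2 * rho + t + s))).
      - intros y. apply Cdisc_impl. lra.
      - apply supported_delta; [lra|]. apply supported_delta; [lra|]. now repeat constructor. }
  rewrite Cmod_mult, !Cmod_inv, !Cmod_Ci_mult, !Rabs_pos_eq by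
    (try apply Ci_mult_neq_0; lra).
  assert (Hsq : sqrt (sqnorm f (delta s (delta t [(RtoC 1, x)]))) <= 4 * sqrt M / (N * N')).
  { eapply Rle_trans; [apply sqrt_le_1_alt, Hq|]. right.
    assert (HM0 := bound_nonneg).
    replace (16 * M / (N ^ 2 * N' ^ 2)) with ((4 * sqrt M / (N * N')) ^ 2).
    - apply sqrt_pow2. apply Rmult_le_pos; [pose proof (sqrt_pos M); lra|].
      left; apply Rinv_0_lt_compat. nra.
    - replace (16 * M) with (16 * (sqrt M * sqrt M)) by now rewrite sqrt_sqrt.
      field. lra. }
  replace K with (/ s * / t * (4 * sqrt M / (N * N'))).
  - apply Rmult_le_compat_l; trivial.
    apply Rmult_le_pos; left; now apply Rinv_0_lt_compat.
  - unfold K, s, t. field. lra.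
Qed.

(** Let one of the two steps tend to [0] in the bound on iterated quotients: the
    quotient of [df] appears.  This is second-order information obtained without a second
    derivative. *)
Lemma dual_le_diffq_deriv x m :
  Cdisc x0 (2 * rho) x ->
  dual_le f B (fun y => diffq df (rho / INR (S m)) (x - Cconj y)%C) K.
Proof.
  intros Hx.
  assert (Ht := div_INR_S_pos rho m rho_pos). assert (Ht1 := div_INR_S_le rho m rho_pos).
  apply (dual_le_limit f B (fun n y =>
    diffq (diffq f (rho / INR (S m))) (rho / INR (S n)) (x - Cconj y)%C)).
  2: intros n; now apply dual_le_diffq_diffq.
  intros y Hy. set (t := rho / INR (S m)) in *.
  eapply converges_ext.
  { intros n. apply diffq_swap; [|lra]. assert (H := div_INR_S_pos rho n rho_pos). lra. }
  unfold diffq at 1.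
  eapply converges_ext with (u := fun n =>
    (/ (Ci * t) * (diffq f (rho / INR (S n)) (x - Cconj y + Ci * t)%C
     + - (1) * diffq f (rho / INR (S n)) (x - Cconj y)%C))%C).
  { intros n. unfold Cdiv. ring. }
  replace (diffq df t (x - Cconj y)%C) with
    (/ (Ci * t) * (df (x - Cconj y + Ci * t)%C + - (1) * df (x - Cconj y)%C))%C
    by (unfold diffq, Cdiv; ring).
  apply converges_scal, converges_plus; [|apply converges_scal];
    apply converges_diffq; trivial.
  - apply f_deriv_codiff; trivial. rewrite Cmod_Ci_mult, Rabs_pos_eq; lra.
  - replace (x - Cconj y)%C with (x - Cconj y + 0)%C by ring.
    apply f_deriv_codiff; trivial. rewrite Cmod_0; lra.
Qed.

(** The derivative of the quotient along the segment from [x] to [x + h] is [h]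
    times the quotient of [df], which was just bounded; [h] is an arbitrary complex
    number, since [f] is complex differentiable. *)
Lemma dual_le_diffq_lipschitz x h m :
  Cdisc x0 (2 * rho) x -> Cdisc x0 (2 * rho) (x + h)%C ->
  dual_le f B (fun y => diffq f (rho / INR (S m)) (x + h - Cconj y)%C
    - diffq f (rho / INR (S m)) (x - Cconj y)%C)%C (Cmod h * K).
Proof.
  intros Hx Hxh.
  assert (Ht := div_INR_S_pos rho m rho_pos). assert (Ht1 := div_INR_S_le rho m rho_pos).
  set (t := rho / INR (S m)) in *.
  eapply dual_le_ext.
  2:{ apply (dual_le_mean_value f B
        (fun s y => diffq f t (x + h * s - Cconj y)%C)
        (fun s y => (h * diffq df t (x + h * s - Cconj y))%C)).
      - intros s Hs y Hy.
        eapply path_deriv_ext with (u := fun r : R =>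
          (/ (Ci * t) * (f (x - Cconj y + Ci * t + h * r)%C
            + - (1) * f (x - Cconj y + h * r)%C))%C).
        { intros r. unfold diffq, Cdiv.
          replace (x + h * r - Cconj y + Ci * t)%C
            with (x - Cconj y + Ci * t + h * r)%C by ring.
          replace (x + h * r - Cconj y)%C with (x - Cconj y + h * r)%C by ring. ring. }
        replace (h * diffq df t (x + h * s - Cconj y))%C with
          (/ (Ci * t) * (h * df (x - Cconj y + Ci * t + h * s)%C
            + - (1) * (h * df (x - Cconj y + h * s)%C)))%C.
        2:{ unfold diffq, Cdiv.
          replace (x + h * s - Cconj y + Ci * t)%C
            with (x - Cconj y + Ci * t + h * s)%C by ring.
          replace (x + h * s - Cconj y)%C with (x - Cconj y + h * s)%C by ring. ring. }
        assert (Hxs := Cdisc_convex _ _ _ _ s Hs Hx Hxh).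
        apply path_deriv_scal, path_deriv_plus; [|apply path_deriv_scal];
          apply path_deriv_segment.
        + replace (x - Cconj y + Ci * t + h * s)%C
            with (x + h * s - Cconj y + Ci * t)%C by ring.
          apply f_deriv_codiff; trivial. rewrite Cmod_Ci_mult, Rabs_pos_eq; lra.
        + replace (x - Cconj y + h * s)%C with (x + h * s - Cconj y + 0)%C by ring.
          apply f_deriv_codiff; trivial. rewrite Cmod_0; lra.
      - intros s Hs. apply dual_le_scal, dual_le_diffq_deriv.
        now apply Cdisc_convex. }
  intros y _. cbv beta. rewrite Cmult_1_r, Cmult_0_r, Cplus_0_r. reflexivity.
Qed.

(** Let the step of the quotient tend to [0].  This is a strong Lipschitz
    property of the derivative of the kernel. *)
Lemma dual_le_deriv_lipschitz x h :
  Cdisc x0 (2 * rho) x -> Cdisc x0 (2 * rho) (x + h)%C ->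
  dual_le f B (fun y => df (x + h - Cconj y) - df (x - Cconj y))%C (Cmod h * K).
Proof.
  intros Hx Hxh.
  eapply dual_le_limit.
  2:{ intros n. apply (dual_le_diffq_lipschitz x h n Hx Hxh). }
  intros y Hy. cbv beta.
  eapply converges_ext with (u := fun n =>
    (diffq f (rho / INR (S n)) (x + h - Cconj y)
     + - (1) * diffq f (rho / INR (S n)) (x - Cconj y))%C).
  { intros n. ring. }
  replace (df (x + h - Cconj y) - df (x - Cconj y))%C
    with (df (x + h - Cconj y) + - (1) * df (x - Cconj y))%C by ring.
  apply converges_plus; [|apply converges_scal]; apply converges_diffq; trivial.
  - replace (x + h - Cconj y)%C with (x + h - Cconj y + 0)%C by ring.
    apply f_deriv_codiff; trivial. rewrite Cmod_0; lra.
  - replace (x - Cconj y)%C with (x - Cconj y + 0)%C by ring.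
    apply f_deriv_codiff; trivial. rewrite Cmod_0; lra.
Qed.

(** Mean value inequality for the kernel minus its linear part along the segment. *)
Lemma dual_le_taylor x h :
  Cdisc x0 (2 * rho) x -> Cdisc x0 (2 * rho) (x + h)%C ->
  dual_le f B (fun y => f (x + h - Cconj y) - f (x - Cconj y)
    - h * df (x - Cconj y))%C (Cmod h ^ 2 * K).
Proof.
  intros Hx Hxh.
  eapply dual_le_ext.
  2:{ apply (dual_le_mean_value f B
        (fun s y => f (x - Cconj y + h * s) + (- h * df (x - Cconj y)) * s)%C
        (fun s y => h * (df (x + h * s - Cconj y) - df (x - Cconj y)))%C).
      - intros s Hs y Hy.
        assert (Hxs := Cdisc_convex _ _ _ _ s Hs Hx Hxh).
        replace (h * (df (x + h * s - Cconj y) - df (x - Cconj y)))%C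
          with (h * df (x - Cconj y + h * s) + (- h * df (x - Cconj y)))%C.
        2:{ replace (x - Cconj y + h * s)%C with (x + h * s - Cconj y)%C by ring. ring. }
        apply path_deriv_plus; [|apply path_deriv_linear].
        apply path_deriv_segment.
        replace (x - Cconj y + h * s)%C with (x + h * s - Cconj y + 0)%C by ring.
        apply f_deriv_codiff; trivial. rewrite Cmod_0; lra.
      - intros s Hs.
        apply (dual_le_weaken _ _ _ (Cmod h * (Cmod (h * s) * K))).
        2:{ apply dual_le_scal, dual_le_deriv_lipschitz; trivial.
            now apply Cdisc_convex. }
        rewrite Cmod_mult, Cmod_R, Rabs_pos_eq by lra.
        replace (Cmod h ^ 2 * K) with (Cmod h * (Cmod h * 1 * K)) by ring.
        pose proof (Cmod_ge_0 h). pose proof K_ge_0.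
        repeat (apply Rmult_le_compat_l || apply Rmult_le_compat_r); trivial; lra. }
  intros y _. cbv beta.
  replace (x - Cconj y + h * RtoC 1)%C with (x + h - Cconj y)%C by ring.
  rewrite Cmult_0_r, Cplus_0_r. ring.
Qed.

(** The finite combination behind the increment minus [h] times the imaginary
    secant.  The secant replaces the derivative because the derivative is a limit,
    not a combination, and so cannot be paired with points far from [x0]. *)
Definition secant_comb (h : C) (t : R) : list (C * C) :=
  [(RtoC 1, (x0 + h)%C); ((h / (Ci * t) - 1)%C, x0); ((- (h / (Ci * t)))%C, (x0 + Ci * t)%C)].

Lemma kernel_comb_secant h t y :
  kernel_comb f (secant_comb h t) y
    = (f (x0 - Cconj y + h) - f (x0 - Cconj y)
       - h * diffq f t (x0 - Cconj y))%C.
Proof.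
  unfold secant_comb, diffq. cbn [kernel_comb fst snd].
  replace (x0 + h - Cconj y)%C with (x0 - Cconj y + h)%C by ring.
  replace (x0 + Ci * t - Cconj y)%C with (x0 - Cconj y + Ci * t)%C by ring.
  unfold Cdiv. ring.
Qed.

(** The first-order error at [h] minus [h / (i t)] times the first-order error at
    [i t]: the unknown derivative cancels. *)
Lemma dual_le_secant h m :
  Cmod h < 2 * rho ->
  dual_le f B (kernel_comb f (secant_comb h (rho / INR (S m))))
    (K * Cmod h * (Cmod h + rho / INR (S m))).
Proof.
  intros Hh.
  assert (Ht := div_INR_S_pos rho m rho_pos). assert (Ht1 := div_INR_S_le rho m rho_pos).
  set (t := rho / INR (S m)) in *.
  assert (HCt : Cmod (Ci * t) = t) by (rewrite Cmod_Ci_mult, Rabs_pos_eq; lra).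
  assert (Hnz : (Ci * t)%C <> 0) by (apply Ci_mult_neq_0; lra).
  eapply dual_le_ext.
  2:{ eapply dual_le_weaken.
      2:{ apply (dual_le_plus f B). 2: apply (dual_le_scal f B (- (h / (Ci * t)))%C).
          - apply (dual_le_taylor x0 h); [apply Cdisc_center|apply Cdisc_center_plus]; lra.
          - apply (dual_le_taylor x0 (Ci * t)%C); [apply Cdisc_center|apply Cdisc_center_plus];
              rewrite ?HCt; lra. }
      rewrite Cmod_opp, Cmod_div, HCt by trivial. right. field. lra. }
  intros y _. cbv beta. rewrite kernel_comb_secant. unfold diffq.
  replace (x0 + h - Cconj y)%C with (x0 - Cconj y + h)%C by ring.
  replace (x0 + Ci * t - Cconj y)%C with (x0 - Cconj y + Ci * t)%C by ring.
  field. split; [apply RtoC_neq; lra|apply Ci_nz].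
Qed.

(** The norm of the combination is controlled near [x0] alone; Cauchy-Schwarz
    over all of [Omega] then evaluates it at any [y0]. *)
Lemma secant_error Omega y0 h m :
  positive_on Omega f -> (forall x, B x -> Omega x) -> Omega y0 ->
  Cmod h < 2 * rho ->
  Cmod (f (x0 - Cconj y0 + h) - f (x0 - Cconj y0)
    - h * diffq f (rho / INR (S m)) (x0 - Cconj y0))%C
  <= K * sqrt (sqnorm f [(RtoC 1, y0)]) * Cmod h * (Cmod h + rho / INR (S m)).
Proof.
  intros HOm HB Hy0 Hh.
  assert (Hdual := dual_le_secant h m Hh).
  assert (Ht := div_INR_S_pos rho m rho_pos). assert (Ht1 := div_INR_S_le rho m rho_pos).
  set (t := rho / INR (S m)) in *.
  assert (Hsup : supported B (secant_comb h t)).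
  { repeat constructor; simpl; unfold B;
      [apply Cdisc_center_plus|apply Cdisc_center|apply Cdisc_center_plus];
      rewrite ?Cmod_Ci_mult, ?Rabs_pos_eq; lra. }
  apply sqnorm_le_dual in Hdual; trivial.
  2:{ pose proof (Cmod_ge_0 h).
    apply Rmult_le_pos; [apply Rmult_le_pos; [apply K_ge_0|trivial]|lra]. }
  rewrite <- kernel_comb_secant.
  assert (HCS := dual_le_kernel_comb f Omega (secant_comb h t) HOm
    (supported_impl _ _ _ HB Hsup) [(RtoC 1, y0)] ltac:(now repeat constructor)).
  cbn [pairing fst snd] in HCS.
  assert (Hconj1 : Cconj (RtoC 1) = RtoC 1)
    by (apply injective_projections; simpl; ring).
  rewrite Hconj1, Cmult_1_l, Cplus_0_r in HCS.
  eapply Rle_trans; [apply HCS|].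
  pose proof (sqrt_pos (sqnorm f [(RtoC 1, y0)])). nra.
Qed.

End NearDiagonal.

(** * Holomorphy on the codifference set *)

Lemma is_derive_has_Cderiv f z l :
  is_derive (K := C_AbsRing) (V := C_NormedModule) f z l <-> has_Cderiv f z l.
Proof.
  split.
  - intros [_ H] eps Heps.
    destruct (H z (fun P HP => HP) (mkposreal eps Heps)) as [d Hd].
    exists (pos d). split; [apply cond_pos|]. intros h Hh.
    assert (E : (z + h - z)%C = h) by ring.
    assert (Hb : ball (M := AbsRing_UniformSpace C_AbsRing) z d (z + h)%C).
    { change (Cmod (z + h - z) < d). now rewrite E. }
    specialize (Hd _ Hb).
    change (Cmod (f (z + h)%C - f z - (z + h - z) * l) <= eps * Cmod (z + h - z)) in Hd.
    now rewrite E in Hd.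
  - intros H. split; [apply is_linear_scal_l|].
    intros x Hx.
    assert (E := is_filter_lim_locally_unique z x Hx). subst x.
    intros [eps Heps]. destruct (H eps Heps) as (d & Hd & Hd').
    exists (mkposreal d Hd). intros y Hy. change (Cmod (y - z) < d) in Hy.
    assert (E : forall w : C, (z + (w - z))%C = w) by (intros; ring).
    specialize (Hd' _ Hy). rewrite E in Hd'. exact Hd'.
Qed.

Lemma open_Cdisc (P : C -> Prop) z :
  open (T := C_UniformSpace) P -> P z ->
  exists r, 0 < r /\ forall y, Cdisc z r y -> P y.
Proof.
  intros HP Hz. destruct (HP z Hz) as [r Hr].
  exists (pos r). split; [apply cond_pos|]. intros y Hy. apply Hr.
  now apply C_NormedModule_mixin_compat1.
Qed.

Lemma has_Cderiv_locally_bounded f z l :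
  has_Cderiv f z l ->
  exists r M, 0 < r /\ forall y, Cdisc z r y -> Cmod (f y) <= M.
Proof.
  intros H. destruct (H 1 ltac:(lra)) as (d & Hd & Hd').
  exists (Rmin d 1), (Cmod (f z) + (Cmod l + 1)). split; [apply Rmin_pos; lra|].
  intros y Hy. unfold Cdisc in Hy.
  specialize (Hd' (y - z)%C ltac:(pose proof (Rmin_l d 1); lra)).
  pose proof (Rmin_r d 1).
  replace (z + (y - z))%C with y in Hd' by ring.
  replace (f y) with (f y - f z - (y - z) * l + (y - z) * l + f z)%C by ring.
  eapply Rle_trans; [apply Cmod_triangle|].
  pose proof (Cmod_triangle (f y - f z - (y - z) * l) ((y - z) * l)).
  rewrite Cmod_mult in H1. pose proof (Cmod_ge_0 l). pose proof (Cmod_ge_0 (y - z)). nra.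
Qed.

Lemma Ccauchy_converges (u : nat -> C) (b : nat -> R) :
  (forall n m, Cmod (u n - u m) <= b n + b m) ->
  (forall eps, 0 < eps -> exists N, forall n, (N <= n)%nat -> b n < eps) ->
  exists l, converges u l.
Proof.
  intros Hu Hb.
  assert (Hpart : forall p : C -> R, (forall x y, Rabs (p x - p y) <= Cmod (x - y)) ->
    exists l, is_lim_seq (fun n => p (u n)) (Finite l)).
  { intros p Hp. apply ex_lim_seq_cauchy_corr. intros eps.
    destruct (Hb (eps / 2)) as [N HN]; [pose proof (cond_pos eps); lra|].
    exists N. intros n m Hn Hm. eapply Rle_lt_trans; [apply Hp|].
    eapply Rle_lt_trans; [apply Hu|]. specialize (HN _ Hn) as Hn'. specialize (HN _ Hm). lra. }
  destruct (Hpart Re) as [a Ha].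
  { intros x y. pose proof (re_le_Cmod (x - y)). simpl in *. exact H. }
  destruct (Hpart Im) as [c Hc].
  { intros x y. replace (Im x - Im y) with (Im (x - y)) by reflexivity.
    eapply Rle_trans; [|apply Rmax_Cmod]. apply Rmax_r. }
  exists (a, c). intros eps Heps.
  apply is_lim_seq_spec in Ha, Hc.
  destruct (Ha (mkposreal (eps / 2) ltac:(lra))) as [N1 HN1].
  destruct (Hc (mkposreal (eps / 2) ltac:(lra))) as [N2 HN2]. simpl in HN1, HN2.
  exists (max N1 N2). intros n Hn.
  specialize (HN1 n ltac:(lia)). specialize (HN2 n ltac:(lia)).
  replace (u n - (a, c))%C with (RtoC (Re (u n) - a) + Ci * RtoC (Im (u n) - c))%C
    by (apply injective_projections; unfold Re, Im; simpl; ring).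
  eapply Rle_trans; [apply Cmod_triangle|].
  rewrite Cmod_R, Cmod_Ci_mult. lra.
Qed.

(** Comparing two secant slopes at the same tiny increment shows that the slopes
    form a Cauchy sequence; their limit is the derivative. *)
Lemma has_Cderiv_of_secants f z (c : nat -> C) A rho :
  0 < rho -> 0 <= A ->
  (forall h m, Cmod h < 2 * rho ->
    Cmod (f (z + h)%C - f z - h * c m) <= A * Cmod h * (Cmod h + rho / INR (S m))) ->
  exists l, has_Cderiv f z l.
Proof.
  intros Hr HA H.
  assert (Hc : forall n m, Cmod (c n - c m) <= A * (rho / INR (S n)) + A * (rho / INR (S m))).
  { intros n m. apply le_epsilon. intros eps Heps.
    (* Any increment [eta] gives the bound up to an error [2 * A * eta]. *)
    set (eta := Rmin rho (eps / (2 * (A + 1)))).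
    assert (Heta : 0 < eta).
    { apply Rmin_pos; trivial. apply Rdiv_lt_0_compat; lra. }
    assert (Heta1 : eta <= rho) by apply Rmin_l.
    assert (Heta2 : 2 * (A + 1) * eta <= eps).
    { apply Rle_trans with (2 * (A + 1) * (eps / (2 * (A + 1)))).
      - apply Rmult_le_compat_l; [lra|apply Rmin_r].
      - right. field. lra. }
    assert (Hm : Cmod eta = eta) by (rewrite Cmod_R, Rabs_pos_eq; lra).
    assert (H1 := H eta n ltac:(lra)). assert (H2 := H eta m ltac:(lra)).
    rewrite Hm in H1, H2.
    apply (Rmult_le_reg_l eta); trivial.
    rewrite <- Hm at 1. rewrite <- Cmod_mult.
    replace (eta * (c n - c m))%C with
      ((f (z + eta)%C - f z - eta * c m) + - (f (z + eta)%C - f z - eta * c n))%C by ring.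
    eapply Rle_trans; [apply Cmod_triangle|]. rewrite Cmod_opp. nra. }
  assert (Hsmall : forall eps, 0 < eps ->
    exists N, forall n, (N <= n)%nat -> A * (rho / INR (S n)) < eps).
  { intros eps Heps.
    destruct (div_INR_S_small rho (eps / (A + 1)) Hr) as [N HN].
    { apply Rdiv_lt_0_compat; lra. }
    exists N. intros n Hn. specialize (HN n Hn).
    assert (0 < rho / INR (S n)) by now apply div_INR_S_pos.
    apply Rle_lt_trans with ((A + 1) * (rho / INR (S n))); [nra|].
    replace eps with ((A + 1) * (eps / (A + 1))) by (field; lra).
    apply Rmult_lt_compat_l; lra. }
  destruct (Ccauchy_converges c _ Hc Hsmall) as [l Hl].
  exists l. intros eps Heps.
  destruct (Hl (eps / 3) ltac:(lra)) as [N1 HN1].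
  destruct (Hsmall (eps / 3) ltac:(lra)) as [N2 HN2].
  specialize (HN1 (max N1 N2) ltac:(lia)). specialize (HN2 (max N1 N2) ltac:(lia)).
  set (n := max N1 N2) in *.
  exists (Rmin rho (eps / (3 * (A + 1)))).
  split; [apply Rmin_pos; trivial; apply Rdiv_lt_0_compat; lra|].
  intros h Hh.
  assert (Hh1 := Rmin_l rho (eps / (3 * (A + 1)))).
  assert (Hh2 := Rmin_r rho (eps / (3 * (A + 1)))).
  specialize (H h n ltac:(lra)).
  assert (Hh3 : 3 * (A + 1) * Cmod h <= eps).
  { apply Rle_trans with (3 * (A + 1) * (eps / (3 * (A + 1)))).
    - apply Rmult_le_compat_l; lra.
    - right. field. lra. }
  replace (f (z + h)%C - f z - h * l)%C
    with ((f (z + h)%C - f z - h * c n) + h * (c n - l))%C by ring.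
  eapply Rle_trans; [apply Cmod_triangle|]. rewrite Cmod_mult.
  pose proof (Cmod_ge_0 h).
  apply Rle_trans with (Cmod h * (A * Cmod h + A * (rho / INR (S n)) + Cmod (c n - l))).
  - nra.
  - rewrite (Rmult_comm eps). apply Rmult_le_compat_l; trivial. nra.
Qed.

Theorem theorem3p21 (Omega : C -> Prop) (f : C -> C) (U : C -> Prop)
    (Omega_nonempty : exists x : C, Omega x)
    (Omega_open : open (T := C_UniformSpace) Omega)
    (f_posdef : positive_definite_function Omega f)
    (U_open : open (T := C_UniformSpace) U)
    (U_sub : forall z : C, U z -> codifference Omega z)
    (diag_sub : forall z : C, diag_codifference Omega z -> U z)
    (f_hol : holomorphic_on U f) :
  holomorphic_on (codifference Omega) f.
Proof.
  intros z (x0 & y0 & Hx0 & Hy0 & ->).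
  apply positive_definite_positive_on in f_posdef.
  assert (Hw : U (x0 - Cconj x0)%C) by (apply diag_sub; now exists x0).
  assert (Hd : forall z, U z -> has_Cderiv f z (C_derive f z)).
  { intros z Hz. apply is_derive_has_Cderiv.
    apply C_derive_correct; [exact z|now apply f_hol]. }
  destruct (open_Cdisc Omega x0 Omega_open Hx0) as (r1 & Hr1 & Hdisc1).
  destruct (open_Cdisc U _ U_open Hw) as (r2 & Hr2 & Hdisc2).
  destruct (has_Cderiv_locally_bounded f _ _ (Hd _ Hw)) as (r3 & M & Hr3 & HM).
  set (rho := Rmin (r1 / 8) (Rmin (r2 / 16) (r3 / 16))).
  assert (Hrho : 0 < rho) by (repeat apply Rmin_pos; lra).
  assert (Hrho1 : rho <= r1 / 8) by apply Rmin_l.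
  assert (Hrho23 : rho <= Rmin (r2 / 16) (r3 / 16)) by apply Rmin_r.
  assert (Hrho2 := Rmin_l (r2 / 16) (r3 / 16)).
  assert (Hrho3 := Rmin_r (r2 / 16) (r3 / 16)).
  assert (HB : forall x, Cdisc x0 (8 * rho) x -> Omega x).
  { intros x Hx. apply Hdisc1. revert Hx. apply Cdisc_impl. lra. }
  assert (Hpos : positive_on (Cdisc x0 (8 * rho)) f).
  { intros v Hv. apply f_posdef. revert Hv. now apply supported_impl. }
  destruct (has_Cderiv_of_secants f (x0 - Cconj y0)%C
    (fun m => diffq f (rho / INR (S m)) (x0 - Cconj y0)%C)
    (4 * sqrt M / rho ^ 2 * sqrt (sqnorm f [(RtoC 1, y0)])) rho) as [l Hl]; trivial.
  - apply Rmult_le_pos; [now apply K_ge_0|apply sqrt_pos].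
  - intros h m Hh. apply (secant_error f (C_derive f) x0 rho M) with (Omega := Omega); trivial.
    + intros z Hz. apply HM. revert Hz. apply Cdisc_impl. lra.
    + intros z Hz. apply Hd, Hdisc2. revert Hz. apply Cdisc_impl. lra.
  - exists l. now apply is_derive_has_Cderiv.
Qed.
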